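(* Let $n_1,\ldots,n_t$ be positive integers, let $t_e$ and $t_o$ be respectively the number of even and odd integers in the sequence $(n_1,\ldots,n_t)$, and let $f=82\times 35^{2^{t_o}-2}\times 81^{t_e}$. Let $c=\min\{95412,f\}$ if $t=2$ and $c=f$ otherwise. Suppose that $n=\max\{n_1,\ldots,n_t\}$ and that for each $1\leq i\leq t$ we have $n_i\geq 2\lceil \log (nc) \rceil+2$. Then, for sufficiently large $n$, $$\hat{R}(C_{n_1},\ldots,C_{n_t})\leq (\ln c+1)\,c^2\, n.$$
   Context: $C_k$ denotes the cycle on $k$ vertices. For graphs $G_1,\ldots,G_k$, the size-Ramsey number $\hat{R}(G_1,\ldots,G_k)$ is the smallest integer $m$ for which there exists a graph $H$ with $m$ edges such that for every coloring of the edges of $H$ with colors $1,\ldots,k$ there is, for some $i$, a copy of $G_i$ in $H$ all of whose edges have color $i$. $\log$ denotes the logarithm to base $2$ and $\ln$ the natural logarithm. *)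

(* Defs.v *)
From HB Require Import structures.
From mathcomp Require Import all_boot all_order all_algebra.
From mathcomp Require Import reals exp.
From Stdlib Require Import ClassicalEpsilon.
Set Implicit Arguments. Unset Strict Implicit. Unset Printing Implicit Defensive.
Import Order.TTheory GRing.Theory Num.Theory.

Definition simple_graph (V : finType) (e : rel V) : Prop :=
  symmetric e /\ irreflexive e.

Definition edges (V : finType) (e : rel V) : {set {set V}} :=
  [set [set p.1; p.2] | p in [set q : V * V | e q.1 q.2]].

Definition mono_cycle (V : finType) (e : rel V) (t : nat)
    (col : {set V} -> 'I_t) (i : 'I_t) (k : nat) : Prop :=
  exists f : nat -> V,
    {in gtn k &, injective f} /\
    forall j, j < k ->
      e (f j) (f (j.+1 %% k)) /\ col [set f j; f (j.+1 %% k)] = i.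

Definition arrows_cycles (ns : seq nat) (V : finType) (e : rel V) : Prop :=
  forall col : {set V} -> 'I_(size ns),
    exists i : 'I_(size ns), mono_cycle e col i (nth 0 ns i).

Definition sr_witness (ns : seq nat) (m : nat) : Prop :=
  exists (V : finType) (e : rel V),
    [/\ simple_graph e, #|edges e| = m & arrows_cycles ns e].

Definition prop_to_bool (P : Prop) : bool :=
  if excluded_middle_informative P then true else false.

(* The size-Ramsey number: smallest m admitting such an H
   (default 0 if no such graph exists -- never the case by Ramsey's thm). *)
Definition sizeRamsey (ns : seq nat) : nat :=
  match excluded_middle_informative (exists m, sr_witness ns m) with
  | left h => @ex_minn (fun m => prop_to_bool (sr_witness ns m))
                (let: ex_intro m hm := h in
                 ex_intro _ m (match excluded_middle_informative (sr_witness ns m)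
                               as b return (if b then true else false) = true
                               with left _ => erefl | right hn => False_ind _ (hn hm) end))
  | right _ => 0
  end.

Local Open Scope ring_scope.

Definition t_even (ns : seq nat) : nat := count (fun k => ~~ odd k) ns.
Definition t_odd (ns : seq nat) : nat := count odd ns.

(* f = 82 * 35^(2^t_o - 2) * 81^t_e  (integer exponent, so for t_o = 0 the
   factor is 35^(-1)) *)
Definition f_const (R : realType) (ns : seq nat) : R :=
  82 * (35 : R) ^ ((2 ^ t_odd ns)%N%:Z - 2)%R * (81 : R) ^+ t_even ns.

Definition c_const (R : realType) (ns : seq nat) : R :=
  if size ns == 2%N then Num.min (95412%:R) (f_const R ns) else f_const R ns.

Definition log2 (R : realType) (x : R) : R := ln x / ln 2.

(* Main.v *)
(**
Some graph H on N = a n vertices, with at most (ln c + 1) c^2 n edges, has an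
edge between any two disjoint n-sets: by the union bound a random graph has this
property as soon as a + 1 <= c, and a greedy hitting set replaces the random
choice.

Colour H and consider one colour. If two disjoint sets of 17 h vertices have an
edge of that colour between any two of their h-subsets, then, after deleting the
badly expanding vertices, the Friedman-Pippenger method embeds between them a
tree consisting of two binary trees hanging at the ends of a path of prescribed
odd length. Both leaf sets have at least h elements, so an edge between them closes
an even cycle of prescribed length; a common neighbour of two leaves in a third set
that is joined in the same way to the first two closes an odd one.

Hence, in the absence of the prescribed cycles, a pair of 17 h-sets contains a pair
of h-sets without edges of a given even colour, and a triple of 17 h-sets contains
such a pair for a given odd colour. If a set of b h vertices always contains a pair
of h-sets avoiding a list of colours, then 17 b h vertices suffice to avoid one more
even colour, and 17 b^2 h vertices one more odd colour (three sets avoiding the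
former colours are obtained by using the property twice). Starting from b = 2 this
gives a = 17^(t_e) 34^(2^(t_o)) / 17 and two n-sets without any edge of H between
them, a contradiction.
*)
Require Import Defs.
From HB Require Import structures.
From mathcomp Require Import all_boot all_order all_algebra.
From mathcomp Require Import reals exp.
From mathcomp Require Import sequences zify ring lra.
From Stdlib Require Import ClassicalEpsilon.
Import Order.TTheory GRing.Theory Num.Theory.

Set Implicit Arguments. Unset Strict Implicit. Unset Printing Implicit Defensive.

(** * Extendable embeddings *)

Section Graph.
Variables (V : finType) (e : rel V).
Implicit Types (A B L M P Q S T X Y Z : {set V}) (cap : V -> nat).

Definition nbhd Q X : {set V} := [set y in Q | [exists x in X, e x y]].

Lemma in_nbhd Q X y :
  reflect (y \in Q /\ exists2 x, x \in X & e x y) (y \in nbhd Q X).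
Proof. by rewrite inE; apply: (iffP andP) => -[-> /exists_inP]. Qed.

Lemma nbhd_sub Q X : nbhd Q X \subset Q.
Proof. by apply/subsetP => y /in_nbhd []. Qed.

Lemma nbhdU Q X Y : nbhd Q (X :|: Y) = nbhd Q X :|: nbhd Q Y.
Proof.
apply/setP => y; rewrite in_setU; apply/in_nbhd/orP => [[Qy [x]]|].
  by rewrite in_setU => /orP[] xX exy; [left|right]; apply/in_nbhd; split=> //; exists x.
by case=> /in_nbhd [Qy [x xX exy]]; split=> //; exists x; rewrite // in_setU xX ?orbT.
Qed.

Lemma nbhdS Q X Y : X \subset Y -> nbhd Q X \subset nbhd Q Y.
Proof. by move=> /setUidPr <-; rewrite nbhdU subsetUl. Qed.

Lemma nbhdD Q X Y : nbhd (Q :\: Y) X = nbhd Q X :\: Y.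
Proof. by apply/setP => y; rewrite !inE andbA. Qed.

Lemma sum_setUI cap X Y :
  \sum_(x in X :|: Y) cap x + \sum_(x in X :&: Y) cap x =
  \sum_(x in X) cap x + \sum_(x in Y) cap x.
Proof.
have -> : X :|: Y = X :|: (Y :\: X) by apply/setP => x; rewrite !inE; case: (x \in X).
rewrite (big_setID X) /= setUK setDUl setDv set0U setDDl setUid -addnA.
by congr (_ + _); rewrite [in RHS](big_setID X) /= addnC setIC.
Qed.

(** Neighbourhoods commute with unions, and a neighbour of [X :&: Y] is a neighbour of both sets.
    This submodularity is what lets tight sets be united. *)
Lemma card_nbhd_submod Q S X Y :
  #|nbhd Q (X :|: Y) :\: S| + #|nbhd Q (X :&: Y) :\: S| <=
  #|nbhd Q X :\: S| + #|nbhd Q Y :\: S|.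
Proof.
rewrite nbhdU setDUl -[leqRHS]cardsUI leq_add2l subset_leq_card //.
by rewrite -setDIl setSD // subsetI !nbhdS ?subsetIl ?subsetIr.
Qed.

(* [S] is the set of vertices used so far and [cap x] the number of children
   that [x] may still receive. *)
Definition extendable P Q S h cap := forall X, X \subset P -> #|X| <= h.*2 ->
  \sum_(x in X) cap x <= #|nbhd Q X :\: S|.

(* Otherwise every candidate child lies in the neighbourhood of a tight set
   avoiding [s]. Tight sets are closed under union by submodularity, so the
   largest one, together with [s], violates extendability. *)
Lemma extendable_step P Q S h cap s : 0 < h -> s \in P -> 0 < cap s ->
  extendable P Q S h cap ->
  (forall X, X \subset P -> h < #|X| <= h.*2 ->
     \sum_(x in X) cap x < #|nbhd Q X :\: S|) ->
  exists y, [/\ y \in Q, y \notin S, e s y &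
    extendable P Q (y |: S) h (fun x => cap x - (x == s))].
Proof.
move=> h0 sP cs ext big.
pose ok y := [forall X : {set V}, (X \subset P) && (#|X| <= h.*2) ==>
  (\sum_(x in X) (cap x - (x == s)) <= #|nbhd Q X :\: (y |: S)|)].
have [y /andP[yN /forallP oky]|bad] :=
    pickP [pred y | (y \in nbhd Q [set s] :\: S) && ok y].
  move: yN; rewrite in_setD => /andP[yS /in_nbhd [yQ [x /set1P -> esy]]].
  by exists y; split=> // X XP Xh; have := oky X; rewrite XP Xh.
pose tight X := [&& X \subset P, #|X| <= h, s \notin X &
   #|nbhd Q X :\: S| == \sum_(x in X) cap x].
have tight0 : tight set0.
  rewrite /tight sub0set cards0 in_set0 big_set0 /= cards_eq0; apply/eqP/setP => y.
  by rewrite !inE; apply/negbTE; rewrite !negb_and; apply/orP; right; apply/orP; right;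
    apply/exists_inPn => x; rewrite inE.
case: (arg_maxnP (fun X : {set V} => #|X|) tight0) => Z /and4P[ZP Zh sZ /eqP tZ] Zmax.
have NZ y : y \in nbhd Q [set s] :\: S -> y \in nbhd Q Z.
  move=> yN; have := bad y; rewrite inE yN /= => /negbT /forallPn [X].
  rewrite negb_imply -ltnNge => /andP[/andP[XP Xh] lt].
  have extX := ext X XP Xh.
  have sumX : \sum_(x in X) cap x = \sum_(x in X) (cap x - (x == s)) + (s \in X).
    case: (boolP (s \in X)) => sX.
      rewrite (bigD1 s) //= [in RHS](bigD1 s) //= eqxx.
      rewrite [X in _ = _ - _ + X + _](_ : _ = \sum_(x in X | x != s) cap x).
        by move: cs; clear; lia.
      by apply: eq_bigr => x /andP[_ /negbTE ->]; rewrite subn0.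
    rewrite addn0; apply: eq_bigr => x xX; case: eqP => [xs|_]; last by rewrite subn0.
    by rewrite xs (negbTE sX) in xX.
  have cardX : #|nbhd Q X :\: S| = #|nbhd Q X :\: (y |: S)| + (y \in nbhd Q X).
    rewrite (cardsD1 y (nbhd Q X :\: S)) addnC setDDl setUC; congr (_ + _).
    by move: yN; rewrite in_setD in_setD => /andP[-> _].
  (* Using [y] costs [X] at most one neighbour, and its demand drops by one when [s] is in [X]. A
     violated inequality was therefore tight before, with [s] outside [X] and [y] adjacent to
     [X]. *)
  have [sX yX] : s \notin X /\ y \in nbhd Q X.
    by move: lt sumX cardX extX; case: (s \in X); case: (y \in nbhd Q X) => //=;
      clear; lia.
  have tX : #|nbhd Q X :\: S| = \sum_(x in X) cap x.
    by move: lt sumX cardX extX; rewrite (negbTE sX) yX /=; clear; lia.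
  (* Strictness in [big] forces the tight set [X] down to [h] vertices, so its union with [Z] stays
     within the range of [ext]. *)
  have Xh1 : #|X| <= h.
    rewrite leqNgt; apply/negP => hX; have := big X XP; rewrite hX Xh tX ltnn.
    by move/(_ isT).
  have UP : X :|: Z \subset P by rewrite subUset XP.
  have Uh : #|X :|: Z| <= h.*2.
    by rewrite cardsU; move: Xh1 Zh; clear; lia.
  have IP : X :&: Z \subset P by rewrite subIset ?XP.
  have Ih : #|X :&: Z| <= h.*2.
    by apply: leq_trans Xh; rewrite subset_leq_card ?subsetIl.
  have tU : #|nbhd Q (X :|: Z) :\: S| = \sum_(x in X :|: Z) cap x.
    have := ext _ UP Uh; have := ext _ IP Ih; have := card_nbhd_submod Q S X Z.
    have := sum_setUI cap X Z; move: tX tZ; clear; lia.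
  have tightU : tight (X :|: Z).
    rewrite /tight UP tU eqxx in_setU negb_or sX sZ /= andbT leqNgt.
    apply/negP => hU; have := big _ UP; rewrite hU Uh tU ltnn.
    by move/(_ isT).
  have /eqP EZ : Z == X :|: Z by rewrite eqEcard subsetUr /=; apply: Zmax.
  by rewrite EZ nbhdU in_setU yX.
have sZP : s |: Z \subset P by rewrite subUset sub1set sP.
have sZh : #|s |: Z| <= h.*2 by rewrite cardsU1 sZ -addnn leq_add.
have := ext _ sZP sZh; rewrite big_setU1 //= -tZ.
suff -> : nbhd Q (s |: Z) :\: S = nbhd Q Z :\: S by lia.
rewrite nbhdU; apply/setP => y; have := NZ y; rewrite !in_setD !in_setU.
by case: (y \in S) => //=; case: (y \in nbhd Q [set s]) => //= ->.
Qed.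

(** * Growing trees between two expanding sides *)

Section Grow.
Variables (P : bool -> {set V}) (h : nat).
Hypothesis h_gt0 : 0 < h.
Hypothesis P_disj : [disjoint P true & P false].
Hypothesis P_big : forall b X, X \subset P b -> h < #|X| <= h.*2 ->
  15 * h < #|nbhd (P (~~ b)) X|.

Lemma P_disjN b x : x \in P b -> x \notin P (~~ b).
Proof.
case: b => /= xP; first by rewrite (disjointFr P_disj xP).
by rewrite (disjointFl P_disj xP).
Qed.

(** The invariant of the embedding. Sides are indexed by booleans because the tree alternates
    between them and both must remain extendable. *)
Definition grown S cap := [/\ forall x, cap x <= 2,
  forall x, x \notin S -> cap x = 2, S \subset P true :|: P false &
  forall b, extendable (P b) (P (~~ b)) S h cap].

(** A set of more than [h] and at most [2h] vertices has over [15h] neighbours, at most [10h] of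
    them used, and demands at most [4h]: large sets are never tight. *)
Lemma grown_step S cap b s : grown S cap -> s \in S -> s \in P b -> 0 < cap s ->
  #|S| <= 10 * h ->
  exists y, [/\ y \in P (~~ b), y \notin S, e s y &
    grown (y |: S) (fun x => cap x - (x == s))].
Proof.
move=> [cap2 capS SP ext] sS sP cs Sh.
have cap_le X : \sum_(x in X) cap x <= 2 * #|X|.
  rewrite mulnC -sum_nat_const; exact: leq_sum.
have [|y [yP yS esy exty]] := extendable_step h_gt0 sP cs (ext b).
  move=> X XP Xh; have := P_big XP Xh; have := cap_le X.
  have := cardsID S (nbhd (P (~~ b)) X).
  have := subset_leq_card (subsetIr (nbhd (P (~~ b)) X) S).
  by case/andP: Xh => _; lia.
exists y; split=> //; split.
- by move=> x; apply: leq_trans (leq_subr _ _) (cap2 x).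
- move=> x; rewrite in_setU1 negb_or => /andP[_ xS]; rewrite (capS _ xS).
  by case: eqP => // xs; rewrite xs sS in xS.
- rewrite subUset SP andbT sub1set in_setU.
  by case: b yP {sP exty} => /= ->; rewrite ?orbT.
move=> b'; case: (altP (b' =P b)) => [->|] //; move/negPf => bb'.
have {bb'}-> : b' = ~~ b by case: b b' bb' {sP yP exty} => [] [].
(* For the other side, [y] is not among the candidate children, and capacities only decrease. *)
move=> X XP Xh; rewrite negbK.
have -> : nbhd (P b) X :\: (y |: S) = nbhd (P b) X :\: S.
  apply/setP => z; rewrite !in_setD in_setU1 negb_or.
  case: eqP => //= ->; rewrite yS /=; apply/esym/negbTE/negP => /in_nbhd [yb _].
  by have := P_disjN yb; rewrite yP.
have := ext (~~ b) X XP Xh; rewrite negbK; apply: leq_trans.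
by apply: leq_sum => x _; apply: leq_subr.
Qed.

(* A shape [bs] prescribes a rooted tree level by level: every vertex of the
   level has two children for [true], one for [false]. *)
Fixpoint nleaves (bs : seq bool) := if bs is b :: bs' then b.+1 * nleaves bs' else 1.
Fixpoint nbelow (bs : seq bool) := if bs is b :: bs' then b.+1 * (nbelow bs').+1 else 0.

(** The tree itself is not stored; only its root-to-leaf paths are, with the vertices beyond the
    root confined to [T]. *)
Definition branch c (T : {set V}) n l := exists p, [/\ path e c p, last c p = l,
  uniq (c :: p), size p = n & {subset p <= T}].

Lemma branch_cons c y T (T' : {set V}) n l : e c y -> branch y T n l -> y \in T' -> T \subset T' ->
  c \notin T' -> branch c T' n.+1 l.
Proof.
move=> ecy [p [pth lst unq sz sub]] yT' TT' cT'.
have subT' : {subset y :: p <= T'}.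
  move=> x; rewrite inE => /orP[/eqP -> //|/sub]; exact: (subsetP TT').
exists (y :: p); split=> //; first by rewrite /= ecy.
- rewrite cons_uniq unq andbT; apply/negP => /subT' cT; by rewrite cT in cT'.
- by rewrite /= sz.
Qed.

Lemma branch_last c T n l : branch c T n l -> l \in c |: T.
Proof.
case=> p [_ <- _ _ sub]; have := mem_last c p.
by rewrite !inE => /orP[-> //|/sub ->]; rewrite orbT.
Qed.

(** Subtrees are grown one after the other. Capacities of used vertices other than the root are
    preserved, so the second child still has capacity 2 when its turn comes. *)
Lemma grow bs : forall S cap b c, grown S cap -> c \in S -> c \in P b -> cap c = 2 ->
  #|S| + nbelow bs <= 10 * h ->
  exists S' cap' (L : {set V}), [/\ grown S' cap', S \subset S',
    #|S'| <= #|S| + nbelow bs, {in S, forall x, x != c -> cap' x = cap x} &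
    [/\ L \subset P (b (+) odd (size bs)), #|L| = nleaves bs &
        {in L, forall l, branch c (S' :\: S) (size bs) l}]].
Proof.
elim: bs => [|b1 bs IH] S cap b c gr cS cP c2 Sh.
  exists S, cap, [set c]; split=> //=; first by rewrite addn0.
  split; rewrite ?cards1 ?sub1set ?addbF // => l /set1P ->.
  by exists [::]; split.
have ySc y : y \notin S -> y != c by apply: contraNneq => ->.
have [||y [yP yS ecy gr1]] := grown_step gr cS cP.
- by rewrite c2.
- lia.
have capy : cap y - (y == c) = 2 by rewrite (negbTE (ySc _ yS)) subn0; case: gr => _ ->.
have par n : b (+) odd n.+1 = ~~ b (+) odd n by rewrite /= addbN addNb.
case: b1 Sh => Sh; last first.
  have [|S' [cap' [L [gr' SS' Sh' eqc [LP Lc Lb]]]]] := IH _ _ _ _ gr1 (setU11 y S) yP capy.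
    by rewrite cardsU1 yS; move: Sh => /=; clear; lia.
  exists S', cap', L; split=> //.
  - by apply: subset_trans SS'; apply: subsetUr.
  - by move: Sh'; rewrite cardsU1 yS /=; clear; lia.
  - move=> x xS xc; rewrite eqc ?in_setU1 ?xS ?orbT //.
      by rewrite (negbTE xc) subn0.
    by apply: contraNneq yS => <-.
  split; rewrite ?par //; first by rewrite Lc /= mul1n.
  move=> l /Lb lb; apply: (branch_cons ecy lb); last by rewrite in_setD cS.
    by rewrite in_setD yS; apply: (subsetP SS'); rewrite setU11.
  by apply: setDS; apply: subsetUr.
have cyS : c \in y |: S by rewrite in_setU1 cS orbT.
have [||z [zP zyS ecz gr2]] := grown_step gr1 cyS cP.
- by rewrite eqxx c2.
- by rewrite cardsU1 yS; move: Sh => /=; clear; lia.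
set S2 := z |: (y |: S) in gr2 *.
have zS : z \notin S by apply: contra zyS => zS; rewrite in_setU1 zS orbT.
have yz : y != z by apply: contraNneq zyS => <-; rewrite setU11.
have S2c : #|S2| = #|S|.+2 by rewrite cardsU1 zyS cardsU1 yS.
have yS2 : y \in S2 by rewrite !in_setU1 eqxx orbT.
have zS2 : z \in S2 by rewrite setU11.
have SS2 : S \subset S2 by apply/subsetP => x xS; rewrite !in_setU1 xS !orbT.
have capy2 : cap y - (y == c) - (y == c) = 2.
  by rewrite capy (negbTE (ySc _ yS)).
have capz2 : cap z - (z == c) - (z == c) = 2.
  by rewrite (negbTE (ySc _ zS)) !subn0; case: gr => _ ->.
have [|S3 [cap3 [L [gr3 S23 S3h eq3 [LP Lc Lb]]]]] := IH _ _ _ _ gr2 yS2 yP capy2.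
  by rewrite S2c; move: Sh => /=; clear; lia.
have zS3 : z \in S3 by apply: (subsetP S23).
have cap3z : cap3 z = 2 by rewrite eq3 // eq_sym.
have [|S4 [cap4 [M [gr4 S34 S4h eq4 [MP Mc Mb]]]]] := IH _ _ _ _ gr3 zS3 zP cap3z.
  by move: Sh S3h; rewrite S2c /=; clear; lia.
have S24 := subset_trans S23 S34.
exists S4, cap4, (L :|: M); split=> //.
- exact: subset_trans S24.
- by move: S4h S3h; rewrite S2c /=; clear; lia.
- move=> x xS xc; have xS2 : x \in S2 by apply: (subsetP SS2).
  rewrite eq4 ?(subsetP S23) //; last by apply: contraNneq zS => <-.
  rewrite eq3 //; last by apply: contraNneq yS => <-.
  by rewrite (negbTE xc) !subn0.
have brL l : l \in L -> branch c (S4 :\: S) (size bs).+1 l.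
  move=> /Lb lb; apply: (branch_cons ecy lb); last by rewrite in_setD cS.
    by rewrite in_setD yS (subsetP S24).
  by apply: setDSS.
have brM l : l \in M -> branch c (S4 :\: S) (size bs).+1 l.
  move=> /Mb lb; apply: (branch_cons ecz lb); last by rewrite in_setD cS.
    by rewrite in_setD zS (subsetP S24).
  by apply: setDS; apply: subset_trans S23.
split.
- by rewrite par subUset LP MP.
(* Leaves below [y] lie in [S3]; those below [z] are outside [S3], or [z] itself, which is no leaf
   of the first subtree. *)
- have -> : #|L :|: M| = #|L| + #|M|; last by rewrite Lc Mc /=; clear; lia.
  apply/eqP; rewrite eqn_leq leq_card_setU /= -cardsUI.
  rewrite (_ : L :&: M = set0) ?cards0 ?addn0 //; apply/setP => l.
  rewrite in_setI in_set0; apply/negP => /andP[/Lb/branch_last lL /Mb/branch_last].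
  rewrite !in_setU1 in lL *; case/orP => [/eqP lz|].
    rewrite lz in lL; move: lL; rewrite eq_sym (negbTE yz) /= in_setD zS2 //.
  rewrite in_setD => /andP[lS3 _]; case/orP: lL => [/eqP ly|].
    by rewrite ly (subsetP S23) in lS3.
  by rewrite in_setD (negbTE lS3) andbF.
by move=> l; rewrite in_setU => /orP[/brL|/brM].
Qed.

End Grow.
End Graph.

(** * Cycles in joined sets *)

Section Joined.
Variables (V : finType) (e : rel V).
Hypothesis e_sym : symmetric e.
Implicit Types (A B C X Y Z : {set V}).

Definition joined h A B := forall X Y, X \subset A -> Y \subset B ->
  h <= #|X| -> h <= #|Y| -> exists x y, [/\ x \in X, y \in Y & e x y].

Lemma joinedC h A B : joined h A B -> joined h B A.
Proof.
move=> jAB X Y XB YA hX hY; have [x [y [xY yX exy]]] := jAB _ _ YA XB hY hX.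
by exists y, x; rewrite e_sym.
Qed.

Lemma joinedS h A B A' B' : A' \subset A -> B' \subset B -> joined h A B -> joined h A' B'.
Proof.
by move=> AA' BB' jAB X Y XA YB; apply: jAB; [apply: subset_trans AA'|apply: subset_trans BB'].
Qed.

Lemma joined_nbhd h A B X : joined h A B -> X \subset A -> h <= #|X| ->
  #|B| < h + #|nbhd e B X|.
Proof.
move=> jAB XA hX; rewrite -(cardsID (nbhd e B X) B) (setIidPr (nbhd_sub _ _ _)).
rewrite addnC ltn_add2r ltnNge; apply/negP => hY.
have [|x [y [xX]]] := jAB X (B :\: nbhd e B X) XA _ hX hY; first exact: subsetDl.
rewrite in_setD => /andP[/negP nyN yB] exy; apply: nyN.
by apply/in_nbhd; split=> //; exists x.
Qed.

(* Remove from both sides a largest pair of sets of at most [h] vertices that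
   expand badly. *)
Lemma expanding_sides (P : bool -> {set V}) h : 0 < h ->
  (forall b, 17 * h <= #|P b|) -> joined h (P true) (P false) ->
  exists P' : bool -> {set V}, [/\ forall b, P' b \subset P b,
    forall b, 16 * h <= #|P' b| &
    forall b X, X \subset P' b -> #|X| <= h -> 3 * #|X| <= #|nbhd e (P' (~~ b)) X|].
Proof.
move=> h0 Ph jP.
have jPb b : joined h (P b) (P (~~ b)) by case: b => //=; apply: joinedC.
pose bad (F : bool -> {set V}) b := [&& F b \subset P b, #|F b| <= h &
  #|nbhd e (P (~~ b)) (F b) :\: F (~~ b)| <= 3 * #|F b|].
have [F badF Fmax] : exists2 F, forall b, bad F b &
    forall F', (forall b, bad F' b) ->
      #|F' true| + #|F' false| <= #|F true| + #|F false|.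
  pose badf (F : {ffun bool -> {set V}}) := [forall b, bad F b].
  have bad0 : badf [ffun=> set0].
    apply/forallP => b; rewrite /bad !ffunE sub0set cards0 setD0 /= leqn0 cards_eq0.
    apply/eqP/setP => y; rewrite in_set0; apply/negP => /in_nbhd [_ [x]].
    by rewrite in_set0.
  case: (arg_maxnP (fun F : {ffun bool -> {set V}} => #|F true| + #|F false|) bad0).
  move=> F /forallP badF Fmax; exists F => // F' badF'.
  have := Fmax (finfun F'); rewrite !ffunE; apply; apply/forallP => b.
  by rewrite /bad !ffunE; apply: badF'.
exists (fun b => P b :\: F b); split=> b.
- exact: subsetDl.
- have /and3P[FP Fh _] := badF b.
  by have := Ph b; rewrite cardsD (setIidPr FP); lia.
move=> X; rewrite subsetD => /andP[XP XF] Xh; rewrite leqNgt; apply/negP => lt.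
have X0 : 0 < #|X| by lia.
have /and3P[FP Fh Fe] := badF b; have /and3P[FP' Fh' Fe'] := badF (~~ b).
have cU : #|F b :|: X| = #|F b| + #|X|.
  by apply/eqP; rewrite (leq_card_setU (F b) X) disjoint_sym.
have UP : F b :|: X \subset P b by rewrite subUset FP.
have Ue : #|nbhd e (P (~~ b)) (F b :|: X) :\: F (~~ b)| <= 3 * #|F b :|: X|.
  rewrite nbhdU setDUl; apply: leq_trans (leq_card_setU _ _) _.
  by move: lt; rewrite nbhdD cU mulnDr => lt; rewrite leq_add // ltnW.
(* A union of at most [h] vertices contradicts maximality. A larger one, of at most [2h], has over
   [16h] neighbours, but badness allows [6h] outside [F (~~ b)] and [h] inside. *)
case: (leqP #|F b :|: X| h) => Uh.
  have := Fmax (fun b' => if b' == b then F b :|: X else F b').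
  suff bad' b' : bad (fun b' => if b' == b then F b :|: X else F b') b'.
    by move=> /(_ bad'); case: (b) cU => /= ->; move: X0; clear; lia.
  rewrite /bad; case: (altP (b' =P b)) => [->|nb].
    by rewrite UP Uh; case: (b) Ue.
  have -> : b' = ~~ b by move: nb; case: (b) (b') => [] [].
  rewrite negbK eqxx FP' Fh' /=; move: Fe'; rewrite negbK; apply: leq_trans.
  by apply: subset_leq_card; apply: setDS; apply: subsetUl.
have := joined_nbhd (jPb b) UP (ltnW Uh); have := Ph (~~ b).
have := cardsID (F (~~ b)) (nbhd e (P (~~ b)) (F b :|: X)).
have := subset_leq_card (subsetIr (nbhd e (P (~~ b)) (F b :|: X)) (F (~~ b))).
move: Ue Fh Fh' Xh cU; clear -h0; lia.
Qed.

Lemma nleaves_nseq d : nleaves (nseq d true) = 2 ^ d.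
Proof. by elim: d => //= d ->; rewrite expnS. Qed.

Lemma nbelow_nseq d : (nbelow (nseq d true)).+2 = 2 ^ d.+1.
Proof. by elim: d => //= d IH; rewrite expnS -IH; lia. Qed.

Lemma nleaves_chain x bs : nleaves (nseq x false ++ bs) = nleaves bs.
Proof. by elim: x => //= x ->; rewrite mul1n. Qed.

Lemma nbelow_chain x bs : nbelow (nseq x false ++ bs) = x + nbelow bs.
Proof. by elim: x => //= x ->; rewrite mul1n. Qed.

(** A root [r] gets children [y] and [z]; below [y] hangs a path of [x] edges ending in a binary
    tree of depth [d], below [z] a binary tree of depth [d]. In all, fewer than [9h] vertices are
    used. *)
Lemma linked_sets (P : bool -> {set V}) h d x :
  [disjoint P true & P false] -> (forall b, 17 * h <= #|P b|) ->
  joined h (P true) (P false) -> h <= 2 ^ d < h.*2 -> x <= h -> odd x ->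
  exists b (L M : {set V}), [/\ L \subset P b, M \subset P (~~ b),
    h <= #|L|, h <= #|M| &
    forall l m, l \in L -> m \in M -> exists p, [/\ path e l p, last l p = m,
      uniq (l :: p), size p = d.*2 + x + 2 & {subset l :: p <= P true :|: P false}]].
Proof.
move=> dP Ph jP /andP[hd dh] xh xodd.
have h0 : 0 < h by lia.
have jPb b : joined h (P b) (P (~~ b)) by case: b => //=; apply: joinedC.
have [P' [P'P P'h P'e]] := expanding_sides h0 Ph jP.
have dP' : [disjoint P' true & P' false].
  by apply: disjointWl (P'P true) _; apply: disjointWr (P'P false) _.
have P'big b X : X \subset P' b -> h < #|X| <= h.*2 -> 15 * h < #|nbhd e (P' (~~ b)) X|.
  move=> XP /andP[Xh _].
  have := joined_nbhd (joinedS (P'P b) (P'P (~~ b)) (jPb b)) XP (ltnW Xh).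
  by have := P'h (~~ b); lia.
have [r rP] : exists r, r \in P' true by apply/card_gt0P; have := P'h true; lia.
have gr : grown e P' h [set r] (fun=> 2).
  split=> //; first by rewrite sub1set in_setU rP.
  move=> b X XP Xh; rewrite sum_nat_const.
  have c1 := cardsID [set r] (nbhd e (P' (~~ b)) X).
  have c2 := subset_leq_card (subsetIr (nbhd e (P' (~~ b)) X) [set r]).
  rewrite cards1 in c2.
  (* Expansion by 3 rather than 2 pays for the loss of the root: [3|X| - 1 >= 2|X|] for nonempty
     [X]. *)
  case: (leqP #|X| h) => hX; first by have := P'e b X XP hX; lia.
  by have := P'big b X XP; rewrite hX Xh => /(_ isT); lia.
have rr := set11 r.
have [||y [yP yr ery gr1]] := grown_step h0 dP' P'big gr rr rP => //.
  by rewrite cards1 muln_gt0.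
have r1 : r \in y |: [set r] by rewrite !inE eqxx orbT.
have [||z [zP zr erz gr2]] := grown_step h0 dP' P'big gr1 r1 rP => //.
- by rewrite eqxx.
- by rewrite cardsU1 yr cards1; move: h0; clear; lia.
set S2 := z |: (y |: [set r]) in gr2.
have [yr' zr' zy] : [/\ y != r, z != r & z != y].
  by move: yr zr; rewrite !inE negb_or => -> /andP[-> ->].
have S2c : #|S2| = 3 by rewrite cardsU1 zr cardsU1 yr cards1.
have yS2 : y \in S2 by rewrite !inE eqxx orbT.
have rS2 : r \in S2 by rewrite !inE eqxx !orbT.
have zS2 : z \in S2 by rewrite !inE eqxx.
have b1 := nbelow_nseq d; rewrite expnS in b1.
set bs1 := nseq x false ++ nseq d true.
have b2 : nbelow bs1 = x + nbelow (nseq d true) by apply: nbelow_chain.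
have [||S3 [cap3 [L [gr3 S23 S3h eq3 [LP Lc Lb]]]]] :=
    grow (bs := bs1) h0 dP' P'big gr2 yS2 yP.
- by rewrite (negbTE yr').
- by rewrite S2c b2; move: b1 dh xh; clear; lia.
have zS3 : z \in S3 by apply: (subsetP S23).
have cap3z : cap3 z = 2 by rewrite eq3 // (negbTE zr').
have [|S4 [cap4 [M [gr4 S34 S4h eq4 [MP Mc Mb]]]]] :=
    grow (bs := nseq d true) h0 dP' P'big gr3 zS3 zP cap3z.
  by move: S3h; rewrite S2c b2; move: b1 dh xh; clear; lia.
have S4P : S4 \subset P true :|: P false.
  by case: gr4 => _ _ S4P _; apply: subset_trans S4P _; apply: setUSS.
rewrite /= size_cat !size_nseq in LP Lb; rewrite /= size_nseq in MP Mb.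
(* The leaves have depths [x + d] and [d] below [y] and [z]; as [x] is odd, they fall on opposite
   sides. *)
exists (odd (x + d)), L, M; split.
- exact: subset_trans (P'P _).
- apply: subset_trans MP _; rewrite oddD xodd /= negbK; exact: P'P.
- by rewrite Lc nleaves_chain nleaves_nseq.
- by rewrite Mc nleaves_nseq.
move=> l m /Lb [p [pp lp up sp subp]] /Mb [q [pq lq uq sq subq]].
have rp : r \notin y :: p.
  rewrite inE eq_sym negb_or yr'; apply/negP => /subp; by rewrite in_setD rS2.
have rq : r \notin z :: q.
  rewrite inE eq_sym negb_or zr'; apply/negP => /subq.
  by rewrite in_setD (subsetP S23 _ rS2).
have pS3 : {subset y :: p <= S3}.
  move=> v; rewrite inE => /orP[/eqP ->|/subp]; first exact: (subsetP S23).
  by rewrite in_setD => /andP[].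
have qS4 : {subset z :: q <= S4}.
  move=> v; rewrite inE => /orP[/eqP ->|/subq]; first exact: (subsetP S34).
  by rewrite in_setD => /andP[].
have pq_disj v : v \in y :: p -> v \notin z :: q.
  move=> vp; rewrite inE negb_or; apply/andP; split.
    move: vp; rewrite inE => /orP[/eqP ->|]; first by rewrite eq_sym.
    by apply: contraTneq => ->; apply/negP => /subp; rewrite in_setD zS2.
  by apply/negP => /subq; rewrite in_setD (pS3 _ vp).
(* Up from [l] through [y] to the root, then down through [z] to [m]. *)
pose w := rev (r :: y :: p) ++ z :: q.
have szw : size w = d.*2 + x + 3.
  by rewrite size_cat size_rev /= sp sq; clear; lia.
have uw : uniq w.
  rewrite cat_uniq rev_uniq cons_uniq rp up uq !andTb andbT; apply/hasPn => v vq.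
  rewrite mem_rev inE negb_or; apply/andP; split.
    by apply: contraNneq rq => <-.
  by apply: contraL vq => /pq_disj.
have wP : {subset w <= P true :|: P false}.
  move=> v; rewrite mem_cat mem_rev inE => vw; apply: (subsetP S4P).
  case/orP: vw => [/orP[/eqP ->|/pS3]|/qS4 //]; last exact: (subsetP S34).
  by apply: (subsetP S34); apply: (subsetP S23).
have Ew : w = l :: behead w.
  rewrite /w rev_cons cat_rcons.
  suff -> : rev (y :: p) = l :: behead (rev (y :: p)) by [].
  rewrite -lp; elim/last_ind: (p) => // s a _; by rewrite -rcons_cons rev_rcons last_rcons.
exists (behead w); rewrite -Ew; split=> //; last by rewrite size_behead szw; clear; lia.
  have sw : sorted e w.
    rewrite /w rev_cons cat_rcons.
    have Er : sorted e (r :: z :: q) by rewrite /= erz.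
    have Ep : sorted e (rev (y :: p)).
      rewrite rev_sorted; rewrite /=; move: pp.
      by rewrite (eq_path (e' := fun a b => e b a)) // => a b; rewrite e_sym.
    have -> : rev (y :: p) = rcons (rev p) y by rewrite rev_cons.
    rewrite rev_cons in Ep.
    rewrite cat_rcons; case: (rev p) Ep => [|a s] /=; first by rewrite e_sym ery erz.
    by rewrite rcons_path cat_path /= => /andP[-> ->]; rewrite e_sym ery erz.
  by move: sw; rewrite Ew.
have -> : last l (behead w) = last r w by rewrite Ew.
by rewrite last_cat /= lq.
Qed.

(** The linking path must have [k - 1] edges, whence [x = k - (2d + 3)], odd because [k] is even.
    For odd [k] below, the extra vertex makes it [k - (2d + 4)]. *)
Lemma even_cycle A B h d k : [disjoint A & B] -> 17 * h <= #|A| -> 17 * h <= #|B| ->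
  joined h A B -> h <= 2 ^ d < h.*2 -> ~~ odd k -> d.*2 + 4 <= k <= h ->
  exists p, [/\ uniq p, size p = k & cycle e p].
Proof.
move=> dAB Ah Bh jAB hd ko /andP[dk kh].
pose P (b : bool) := if b then A else B.
have [|||b [L [M [LP MP Lh Mh con]]]] := @linked_sets P h d (k - (d.*2 + 3)) dAB _ jAB hd.
- by case.
- lia.
- by rewrite oddB; [rewrite oddD odd_double (negbTE ko)|lia].
have jPb : joined h (P b) (P (~~ b)) by case: (b) => //=; apply: joinedC.
have [l [m [lL mM elm]]] := jPb _ _ LP MP Lh Mh.
have [p [pp lp up sp _]] := con _ _ lL mM.
exists (l :: p); split=> //; first by rewrite /= sp; move: dk; clear; lia.
by rewrite /= rcons_path pp lp e_sym.
Qed.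

Lemma odd_cycle A B C h d k : [disjoint A & B] -> [disjoint A & C] -> [disjoint B & C] ->
  17 * h <= #|A| -> 17 * h <= #|B| -> 17 * h <= #|C| ->
  joined h A B -> joined h A C -> joined h B C ->
  h <= 2 ^ d < h.*2 -> odd k -> d.*2 + 5 <= k <= h ->
  exists p, [/\ uniq p, size p = k & cycle e p].
Proof.
move=> dAB dAC dBC Ah Bh Ch jAB jAC jBC hd ko /andP[dk kh].
pose P (b : bool) := if b then A else B.
have [|||b [L [M [LP MP Lh Mh con]]]] := @linked_sets P h d (k - (d.*2 + 4)) dAB _ jAB hd.
- by case.
- lia.
- by rewrite oddB; [rewrite oddD odd_double ko|lia].
have jPC b' : joined h (P b') C by case: b'.
have nL := joined_nbhd (jPC b) LP Lh; have nM := joined_nbhd (jPC (~~ b)) MP Mh.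
(* Each of the two neighbourhoods misses fewer than [h] of the at least [17h] vertices of [C]. *)
have [c] : exists c, c \in nbhd e C L :&: nbhd e C M.
  apply/card_gt0P; have := cardsUI (nbhd e C L) (nbhd e C M).
  have : #|nbhd e C L :|: nbhd e C M| <= #|C|.
    by apply: subset_leq_card; rewrite subUset !nbhd_sub.
  by lia.
rewrite in_setI => /andP[/in_nbhd [cC [l lL elc]] /in_nbhd [_ [m mM emc]]].
have [p [pp lp up sp subp]] := con _ _ lL mM.
exists (c :: l :: p); split; last 1 first.
- by rewrite /= rcons_path pp lp emc e_sym elc.
- rewrite cons_uniq up andbT; apply/negP => /subp; rewrite in_setU /=.
  by rewrite (disjointFl dAC cC) (disjointFl dBC cC).
- by rewrite /= sp; move: dk; clear; lia.
Qed.

End Joined.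

(** * Pairs of sets avoiding several colours *)

Section Holes.
Variables (V : finType) (I : eqType) (g : I -> rel V) (k : I -> nat) (n D : nat).
Hypothesis g_sym : forall i, symmetric (g i).
Hypothesis n_gt0 : 0 < n.
Hypothesis k_bounds : forall i, D.*2 + 2 <= k i <= n.
Hypothesis V_small : #|V| <= 2 ^ D.
Hypothesis no_cycle : forall i, ~ exists p, [/\ uniq p, size p = k i & cycle (g i) p].
Implicit Types (A B C W X Y : {set V}).

Definition hole (cs : seq I) X Y := forall i x y,
  i \in cs -> x \in X -> y \in Y -> ~~ g i x y.

Lemma holeS cs X Y X' Y' : X' \subset X -> Y' \subset Y -> hole cs X Y -> hole cs X' Y'.
Proof.
by move=> XX YY hXY i x y ic /(subsetP XX) xX /(subsetP YY); apply: hXY.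
Qed.

Definition hole_in i h A B := exists X Y, [/\ X \subset A, Y \subset B,
  h <= #|X|, h <= #|Y| & hole [:: i] X Y].

Lemma joined_or_hole i h A B : joined (g i) h A B \/ hole_in i h A B.
Proof.
case: (boolP [exists X : {set V}, exists Y : {set V}, [&& X \subset A, Y \subset B,
   h <= #|X|, h <= #|Y| & [forall x in X, forall y in Y, ~~ g i x y]]]).
  move=> /existsP[X /existsP[Y /and5P[XA YB hX hY /forall_inP no]]]; right.
  exists X, Y; split=> // j x y; rewrite inE => /eqP -> xX yY.
  by have /forall_inP := no _ xX; apply.
move=> /existsPn noh; left => X Y XA YB hX hY.
have /existsPn/(_ Y) := noh X; rewrite XA YB hX hY /= => /forall_inPn[x xX].
by move=> /forall_inPn[y yY]; rewrite negbK => gxy; exists x, y.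
Qed.

(** The number of vertices, in units of [h], that guarantees a hole; the head of the list is the
    colour treated last. *)
Fixpoint hole_const (cs : seq I) : nat :=
  if cs is i :: cs' then
    (if odd (k i) then 17 * hole_const cs' ^ 2 else 17 * hole_const cs')
  else 2.

Lemma hole_const_gt0 cs : 0 < hole_const cs.
Proof. by elim: cs => //= i cs IH; case: ifP; rewrite muln_gt0 ?expn_gt0 IH. Qed.

(** Two disjoint sets give [34h <= 2^D], whereas [2^d < 2h]. With [d + 2 <= D], the lower bound
    [2D + 2] on cycle lengths exceeds the [2d + 5] required. *)
Lemma depth_bound h A B : 0 < h -> [disjoint A & B] -> 17 * h <= #|A| -> 17 * h <= #|B| ->
  exists2 d, h <= 2 ^ d < h.*2 & d.+2 <= D.
Proof.
move=> h0 dAB Ah Bh.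
have dh : 2 ^ up_log 2 h < h.*2.
  case: (leqP h 1) => h1; first by have -> : h = 1 by lia.
  have := up_log_gtn (isT : 1 < 2) h1.
  have : 0 < up_log 2 h by rewrite up_log_gt0.
  case: (up_log 2 h) => // m _ /=; rewrite expnS; lia.
exists (up_log 2 h); first by rewrite up_logP.
have : #|A| + #|B| <= #|V|.
  by rewrite -cardsUI (disjoint_setI0 dAB) cards0 addn0 max_card.
move=> AB; rewrite -(leq_exp2l _ _ (isT : 1 < 2)) !expnS; lia.
Qed.

Lemma hole_even i h A B : n <= h -> ~~ odd (k i) -> [disjoint A & B] ->
  17 * h <= #|A| -> 17 * h <= #|B| -> hole_in i h A B.
Proof.
move=> nh ke dAB Ah Bh; case: (joined_or_hole i h A B) => // jAB.
have [|d hd dD] := depth_bound _ dAB Ah Bh; first by lia.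
case: (@no_cycle i); apply: (even_cycle (g_sym i) dAB Ah Bh jAB hd ke).
by have := k_bounds i; lia.
Qed.

Lemma hole_odd i h A B C : n <= h -> odd (k i) ->
  [disjoint A & B] -> [disjoint A & C] -> [disjoint B & C] ->
  17 * h <= #|A| -> 17 * h <= #|B| -> 17 * h <= #|C| ->
  [\/ hole_in i h A B, hole_in i h A C | hole_in i h B C].
Proof.
move=> nh ko dAB dAC dBC Ah Bh Ch.
case: (joined_or_hole i h A B) => [jAB|]; last by constructor.
case: (joined_or_hole i h A C) => [jAC|]; last by constructor.
case: (joined_or_hole i h B C) => [jBC|]; last by constructor.
have [|d hd dD] := depth_bound _ dAB Ah Bh; first by lia.
case: (@no_cycle i).
apply: (odd_cycle (g_sym i) dAB dAC dBC Ah Bh Ch jAB jAC jBC hd ko).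
by have := k_bounds i; lia.
Qed.

(* For an odd colour [i], a pair [X, Y] free of the other colours is refined by
   a second such pair inside [X]: some odd cycle, or a hole, of colour [i]
   appears among the resulting three sets. *)
Lemma hole_exists cs h W : n <= h -> hole_const cs * h <= #|W| ->
  exists X Y, [/\ X \subset W, Y \subset W, [disjoint X & Y],
    h <= #|X| /\ h <= #|Y| & hole cs X Y].
Proof.
elim: cs h W => [|i cs IH] h W nh /=.
  move=> hW; have /card_geqP[s [us sz sub]] : h <= #|W| by lia.
  have XW : [set x in s] \subset W by apply/subsetP => x; rewrite inE => /sub.
  have cX : #|[set x in s]| = h by rewrite cardsE (card_uniqP us).
  exists [set x in s], (W :\: [set x in s]); split=> //.
  - exact: subsetDl.
  - by rewrite disjoint_sym; apply/setDidPl; rewrite setDDl setUid.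
  - by rewrite cardsD (setIidPr XW) cX; lia.
have c0 := hole_const_gt0 cs.
have add_colour A B X Y : hole cs A B -> X \subset A -> Y \subset B -> hole [:: i] X Y ->
    hole (i :: cs) X Y.
  move=> hAB XA YB hXY j x y; rewrite inE => /orP[ji|jcs]; first by apply: hXY; rewrite inE.
  by apply: (holeS XA YB hAB).
case: ifP => ko hW; last first.
  have [||A [B [AW BW dAB [Ah Bh] hAB]]] := IH (17 * h) W; try lia.
  have [X [Y [XA YB hX hY hXY]]] := hole_even nh (negbT ko) dAB Ah Bh.
  exists X, Y; split=> //.
  - exact: subset_trans AW.
  - exact: subset_trans BW.
  - by apply: disjointWl XA _; apply: disjointWr YB _.
  - exact: add_colour hAB XA YB hXY.
(* With [b] the constant of [cs], sets of [17bh] vertices are requested so that [A] can host a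
   further pair of [17h]-sets. *)
have [||A [C [AW CW dAC [Ah Ch] hAC]]] := IH (hole_const cs * (17 * h)) W; first nia.
  by move: hW; rewrite expnS expn1; nia.
have [||A1 [A2 [A1A A2A d12 [A1h A2h] h12]]] := IH (17 * h) A => //; first lia.
have C17 : 17 * h <= #|C| by nia.
have fin B1 B2 : hole cs B1 B2 -> [disjoint B1 & B2] -> B1 \subset W -> B2 \subset W ->
    hole_in i h B1 B2 -> exists X Y, [/\ X \subset W, Y \subset W, [disjoint X & Y],
    h <= #|X| /\ h <= #|Y| & hole (i :: cs) X Y].
  move=> hB dB B1W B2W [X [Y [XB YB hX hY hXY]]]; exists X, Y; split=> //.
  - exact: subset_trans B1W.
  - exact: subset_trans B2W.
  - by apply: disjointWl XB _; apply: disjointWr YB _.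
  - exact: add_colour hB XB YB hXY.
have d1C : [disjoint A1 & C] by apply: disjointWl A1A _.
have d2C : [disjoint A2 & C] by apply: disjointWl A2A _.
have A1W := subset_trans A1A AW; have A2W := subset_trans A2A AW.
have CC := subxx (mem C).
case: (hole_odd nh ko d12 d1C d2C A1h A2h C17); apply: fin => //.
- by apply: holeS hAC.
- by apply: holeS hAC.
Qed.

End Holes.

(** * Dense graphs and the counting bound *)

(* Greedily pick the point lying in the largest number of remaining sets. *)
Lemma hitting_set (T U : finType) (E : U -> {set T}) s M (F : {set U}) :
  {in F, forall u, s <= #|E u|} -> #|F| * (#|T| - s) ^ M < #|T| ^ M ->
  exists2 H : {set T}, #|H| <= M & {in F, forall u, exists2 x, x \in H & x \in E u}.
Proof.
elim: M F => [|M IH] F Es.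
  rewrite muln1 ltnS leqn0 cards_eq0 => /eqP F0; exists set0; rewrite ?cards0 //.
  by move=> u; rewrite F0 inE.
move=> lt; have T0 : 0 < #|T|.
  by move: lt; case: #|T| => //; rewrite sub0n exp0n // muln0.
(* Averaging by double counting: some [x] lies in at least a fraction [s/|T|] of the sets. *)
have [x degx] : exists x, s * #|F| <= #|T| * #|[set u in F | x \in E u]|.
  case: (pickP [pred x | s * #|F| <= #|T| * #|[set u in F | x \in E u]|]) => [x|no].
    by exists x.
  have deg x : #|T| * #|[set u in F | x \in E u]| < s * #|F|.
    by rewrite ltnNge; have := no x; rewrite /= => ->.
  have sum_lt : \sum_(x : T) (#|T| * #|[set u in F | x \in E u]|).+1 <= #|T| * (s * #|F|).
    by rewrite -sum_nat_const; apply: leq_sum => x _; apply: deg.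
  have dbl : \sum_(x : T) #|[set u in F | x \in E u]| = \sum_(u in F) #|E u|.
    under eq_bigr do rewrite -sum1dep_card big_mkcondr.
    by rewrite exchange_big /=; apply: eq_bigr => u _; rewrite -big_mkcond sum1_card.
  have : s * #|F| <= \sum_(u in F) #|E u|.
    by rewrite mulnC -sum_nat_const; apply: leq_sum.
  move: sum_lt; rewrite (eq_bigr (fun x => #|T| * #|[set u in F | x \in E u]| + 1)).
    rewrite big_split /= -big_distrr /= dbl sum1_card -[#|xpredT|]/#|T|.
    move=> lt2 /(leq_mul (leqnn #|T|)) ge.
    by exfalso; move: lt2 ge T0; clear; lia.
  by move=> x _; rewrite addn1.
have [||H Hc Hh] := IH (F :\: [set u in F | x \in E u]).
- by move=> u; rewrite in_setD => /andP[_]; apply: Es.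
(* An empty [F] does not bound [s], and then [|T| - s] may be truncated. *)
- have sT : s <= #|T| \/ F = set0.
    by case: (set_0Vmem F) => [|[u uF]]; [right|left; rewrite (leq_trans (Es _ uF)) ?max_card].
  have cF : #|F :\: [set u in F | x \in E u]| = #|F| - #|[set u in F | x \in E u]|.
    by rewrite cardsD (setIidPr _) //; apply/subsetP => u; rewrite inE => /andP[].
  rewrite -(ltn_pmul2l T0) -expnS; apply: leq_ltn_trans lt.
  rewrite expnS mulnA mulnA leq_mul2r; apply/orP; right; rewrite cF.
  case: sT => [sT|->]; last by rewrite cards0 sub0n !muln0.
  rewrite mulnBr mulnBr; move: degx; nia.
exists (x |: H).
  by rewrite cardsU1; case: (x \in H) => /=; lia.
move=> u uF; case: (boolP (x \in E u)) => xu; first by exists x; rewrite ?setU11.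
have [|y yH yu] := Hh u; first by rewrite in_setD uF inE uF (negbTE xu).
by exists y; rewrite // in_setU1 yH orbT.
Qed.

Lemma ffact_leq_exp n m : n ^_ m <= n ^ m.
Proof. by elim: m => // m IH; rewrite ffactnSr expnSr leq_mul // leq_subr. Qed.

(** Edges are drawn as ordered pairs. A pair of disjoint [n]-sets is hit in either orientation,
    hence by [2n^2] of the [N^2] draws. *)
Lemma dense_graph N n M :
  'C(N, n) ^ 2 * (N ^ 2 - 2 * n ^ 2) ^ M < (N ^ 2) ^ M ->
  exists e : rel 'I_N, [/\ simple_graph e, #|edges e| <= M &
    forall X Y : {set 'I_N}, [disjoint X & Y] -> n <= #|X| -> n <= #|Y| ->
      exists x y, [/\ x \in X, y \in Y & e x y]].
Proof.
set V := 'I_N; move=> lt.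
pose draws := [set X : {set V} | #|X| == n].
pose F := [set p : {set V} * {set V} |
   [&& #|p.1| == n, #|p.2| == n & [disjoint p.1 & p.2]]].
pose E (p : {set V} * {set V}) := setX p.1 p.2 :|: setX p.2 p.1.
have EF : {in F, forall p, 2 * n ^ 2 <= #|E p|}.
  move=> [X Y]; rewrite inE /= => /and3P[/eqP cX /eqP cY dXY].
  have /eqP -> : #|E (X, Y)| == #|setX X Y| + #|setX Y X|.
    rewrite (leq_card_setU (setX X Y) (setX Y X)) -setI_eq0; apply/eqP/setP => -[x y].
    rewrite !inE; apply/negP => /andP[/andP[xX _] /andP[xY _]].
    by rewrite (disjointFr dXY xX) in xY.
  by rewrite /= !cardsX cX cY; lia.
have cF : #|F| <= 'C(N, n) ^ 2.
  have -> : 'C(N, n) ^ 2 = #|setX draws draws|.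
    by rewrite cardsX /draws card_draws card_ord expnS expn1.
  apply: subset_leq_card; apply/subsetP => -[X Y]; rewrite !inE /=.
  by case/and3P => -> ->.
have [|H Hc Hh] := @hitting_set _ _ E (2 * n ^ 2) M F EF.
  rewrite card_prod !card_ord; apply: leq_ltn_trans lt.
  by rewrite leq_mul2r cF orbT.
pose e x y := (x != y) && (((x, y) \in H) || ((y, x) \in H)).
exists e; split.
- split=> [x y|x]; last by rewrite /e eqxx.
  by rewrite /e eq_sym orbC.
- apply: leq_trans Hc.
  have /subset_leq_card : edges e \subset [set [set p.1; p.2] | p in H].
    apply/subsetP => S /imsetP[[x y]]; rewrite inE /= => /andP[_ /orP[xy|yx]] ->.
      by apply/imsetP; exists (x, y).
    by apply/imsetP; exists (y, x); rewrite //= setUC.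
  by move=> le; apply: leq_trans le (leq_imset_card _ _).
move=> X Y dXY /card_geqP[s [us ss subs]] /card_geqP[r [ur sr subr]].
have [|[x y] xyH] := Hh ([set x in s], [set y in r]).
  rewrite inE /= !cardsE (card_uniqP us) (card_uniqP ur) ss sr !eqxx /=.
  apply/pred0P => x /=; apply/negP; rewrite !inE => /andP[/subs xX /subr xY].
  by rewrite (disjointFr dXY xX) in xY.
rewrite !inE /= => /orP[/andP[/subs xX /subr yY]|/andP[/subr xY /subs yX]].
  exists x, y; split=> //; rewrite /e xyH andbT.
  by apply: contraTneq yY => <-; rewrite (disjointFr dXY xX).
exists y, x; split=> //; rewrite /e xyH orbT andbT.
by apply: contraTneq xY => <-; rewrite (disjointFr dXY yX).
Qed.

(** * From holes to the arrow relation *)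

Lemma cycle_mono (V : finType) (e : rel V) t (col : {set V} -> 'I_t) i (p : seq V) :
  uniq p -> cycle (fun x y => e x y && (col [set x; y] == i)) p ->
  0 < size p -> Defs.mono_cycle e col i (size p).
Proof.
case: p => // v p up cp _; exists (nth v (v :: p)); split.
  by move=> j1 j2 j1p j2p /eqP; rewrite nth_uniq // => /eqP.
move=> j jp.
have := pathP v cp j; rewrite size_rcons => /(_ jp).
rewrite nth_rcons -rcons_cons nth_rcons jp.
have -> : (if j < size p then nth v p j else if j == size p then v else v) =
          nth v (v :: p) (j.+1 %% size (v :: p)).
  case: (ltnP j (size p)) => jsp; first by rewrite modn_small.
  have -> : j = size p by move: jp => /=; lia.
  by rewrite eqxx /= modnn.
by case/andP => ? /eqP.
Qed.

Lemma sizeRamsey_le ns m : sr_witness ns m -> sizeRamsey ns <= m.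
Proof.
move=> w; rewrite /sizeRamsey; case: excluded_middle_informative => // h.
case: ex_minnP => m' _; apply.
by rewrite /prop_to_bool; case: excluded_middle_informative.
Qed.

(** Closed form of the iteration that starts at 2, applies [b -> 17b^2] for each odd length, then
    [b -> 17b] for each even one. *)
Definition cycle_const te to := 17 ^ te * (2 * 34 ^ (2 ^ to).-1).

(** Even colours at the head are treated last, so their factors 17 are never squared. For the odd
    ones, [17 (2 34^(m-1))^2 = 2 34^(2m-1)]. *)
Lemma hole_const_cat (I : eqType) (k : I -> nat) (cs : seq I) :
  hole_const k ([seq i <- cs | ~~ odd (k i)] ++ [seq i <- cs | odd (k i)]) =
  cycle_const (count (fun i => ~~ odd (k i)) cs) (count (fun i => odd (k i)) cs).
Proof.
have -> es os : all (fun i => ~~ odd (k i)) es ->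
    hole_const k (es ++ os) = 17 ^ size es * hole_const k os.
  elim: es => [|i es IH] /=; first by rewrite mul1n.
  by case/andP => /negbTE -> /IH ->; rewrite expnS mulnA.
  rewrite -!size_filter /cycle_const; congr (_ * _).
  have := filter_all (fun i => odd (k i)) cs; elim: (filter _ _) => //= i os IH.
  case/andP => -> /IH ->.
  rewrite [2 ^ _.+1]expnS [2 * (2 ^ _)]mul2n -addnn.
  have : 0 < 2 ^ size os by rewrite expn_gt0.
  case: (2 ^ _) => // m _; rewrite addnS addSn -!pred_Sn [34 ^ _.+1]expnS expnD -mulnn; lia.
exact: filter_all.
Qed.

Lemma count_nth (a : pred nat) (ns : seq nat) :
  count (fun i : 'I_(size ns) => a (nth 0 ns i)) (enum 'I_(size ns)) = count a ns.
Proof.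
rewrite -[RHS](congr1 (count a) (mkseq_nth 0 ns)) /mkseq -val_enum_ord -map_comp.
by rewrite count_map; apply: eq_count.
Qed.

(** A hole for the list of all colours contains no edge of [e], since every edge has a colour;
    density forbids this. *)
Lemma dense_graph_arrows ns N n D (e : rel 'I_N) : simple_graph e ->
  all (fun k => D.*2 + 2 <= k <= n) ns -> 0 < n ->
  N = cycle_const (t_even ns) (t_odd ns) * n -> N <= 2 ^ D ->
  (forall X Y : {set 'I_N}, [disjoint X & Y] -> n <= #|X| -> n <= #|Y| ->
      exists x y, [/\ x \in X, y \in Y & e x y]) ->
  arrows_cycles ns e.
Proof.
move=> [e_sym _] /all_nthP kb n0 EN ND dense col; apply: NNPP => none.
pose k (i : 'I_(size ns)) := nth 0 ns i.
pose g i x y := e x y && (col [set x; y] == i).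
pose cs := [seq i <- enum 'I_(size ns) | ~~ odd (k i)] ++
           [seq i <- enum 'I_(size ns) | odd (k i)].
have g_sym i : symmetric (g i) by move=> x y; rewrite /g e_sym setUC.
have kbi i : D.*2 + 2 <= k i <= n by apply: kb.
have nocyc i : ~ exists p, [/\ uniq p, size p = k i & cycle (g i) p].
  move=> [p [up sp cp]]; apply: none; exists i; rewrite -/(k i) -sp.
  apply: cycle_mono cp _ => //; rewrite sp.
  by case/andP: (kbi i) => ki _; apply: leq_trans ki; rewrite addn2.
have [|||X [Y [_ _ dXY [hX hY] hXY]]] :=
    @hole_exists _ _ g k n D g_sym n0 kbi _ nocyc cs n [set: 'I_N].
- by rewrite card_ord.
- by [].
- by rewrite cardsT card_ord EN hole_const_cat (count_nth (fun m => ~~ odd m)) (count_nth odd).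
have [x [y [xX yY exy]]] := dense X Y dXY hX hY.
have ics : col [set x; y] \in cs.
  rewrite mem_cat; apply/orP; case: (boolP (odd (k (col [set x; y])))) => ko; [right|left];
    by rewrite mem_filter ko mem_enum.
by have := hXY _ x y ics xX yY; rewrite /g exy eqxx.
Qed.

(** * Numerical estimates and the final bound *)

Local Open Scope ring_scope.

(** The binomial is at most [(cn)^n / n!], and [n^n / n!] is a term of the series of [e^n]. *)
Lemma bin_le_expR (R : realType) (c n : nat) : (0 < c)%N -> (0 < n)%N ->
  'C(c * n, n)%:R <= expR (n%:R * (ln c%:R + 1)) :> R.
Proof.
move=> c0 n0; have cR : 0 < c%:R :> R by rewrite ltr0n.
have fR : 0 < n`!%:R :> R by rewrite ltr0n fact_gt0.
have En : (n%:R ^+ n / n`!%:R : R) <= expR n%:R.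
  have := @expR_ge1Dxn R n%:R n.-1 (ler0n _ _); rewrite prednK //.
  by apply: le_trans; rewrite lerDr.
rewrite mulrDr mulr1 expRD expRM_natl lnK ?posrE //.
have : ('C(c * n, n)%:R * n`!%:R : R) <= c%:R ^+ n * n%:R ^+ n.
  by rewrite -natrM bin_ffact -exprMn -natrM -natrX ler_nat ffact_leq_exp.
rewrite -ler_pdivlMr // => le; apply: (le_trans le).
by rewrite -mulrA ler_wpM2l // exprn_ge0 ?ler0n.
Qed.

(** By [1 - u <= exp(-u)] with [u = 2/c^2], the quotient of the two sides is at most
    [exp(2n(ln c + 1) - 2M/c^2)], whose exponent is negative. *)
Lemma dense_graph_count (R : realType) (c n M : nat) : (1 < c)%N -> (0 < n)%N ->
  c%:R ^+ 2 * n%:R * (ln c%:R + 1) < M%:R :> R ->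
  ('C(c * n, n) ^ 2 * ((c * n) ^ 2 - 2 * n ^ 2) ^ M < ((c * n) ^ 2) ^ M)%N.
Proof.
move=> c1 n0 lt; have cR : 0 < c%:R :> R by rewrite ltr0n; lia.
have c2R : 0 < c%:R ^+ 2 :> R by rewrite exprn_gt0.
have NR : 0 < ((c * n) ^ 2)%:R :> R by rewrite ltr0n expn_gt0 muln_gt0; lia.
rewrite -(ltr_nat R) natrM !natrX.
have step : ((c * n) ^ 2 - 2 * n ^ 2)%:R <= ((c * n) ^ 2)%:R * expR (- (2 / c%:R ^+ 2)) :> R.
  apply: le_trans (ler_wpM2l (ltW NR) (expR_ge1Dx _)).
  rewrite natrB; last by rewrite expnMn leq_mul2r; apply/orP; right; nia.
  rewrite !(natrX, natrM) exprMn.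
  rewrite (_ : _ * (1 - _) = c%:R ^+ 2 * n%:R ^+ 2 - 2 * n%:R ^+ 2) //.
  by field; rewrite gt_eqF.
have binle : ('C(c * n, n)%:R ^+ 2 : R) <= expR (n%:R * (ln c%:R + 1)) ^+ 2.
  by rewrite lerXn2r ?nnegrE ?expR_ge0 ?ler0n ?bin_le_expR //; lia.
have stepM : ((c * n) ^ 2 - 2 * n ^ 2)%:R ^+ M <=
    ((c * n) ^ 2)%:R ^+ M * expR (- (2 / c%:R ^+ 2)) ^+ M :> R.
  by rewrite -exprMn lerXn2r ?nnegrE ?ler0n // mulr_ge0 ?expR_ge0 ?ler0n.
apply: le_lt_trans (ler_pM _ _ binle stepM) _; rewrite ?exprn_ge0 ?ler0n //.
rewrite mulrCA -[ltRHS]mulr1 natrX ltr_pM2l; last by rewrite -natrX exprn_gt0.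
rewrite -!expRM_natl -expRD -[ltRHS]expR0 ltr_expR.
have : c%:R ^+ 2 * (n%:R * (ln c%:R + 1)) < M%:R :> R by rewrite mulrA.
rewrite -ltr_pdivlMl // => lt2.
rewrite (_ : _ + _ = 2 * (n%:R * (ln c%:R + 1) - (c%:R ^+ 2)^-1 * M%:R)); first lra.
by field; rewrite gt_eqF.
Qed.

Lemma cycle_const_le (R : realType) ns : (0 < size ns)%N ->
  (cycle_const (t_even ns) (t_odd ns))%:R + 1 <= c_const R ns :> R.
Proof.
move=> ns0; have Et : (t_even ns + t_odd ns = size ns)%N.
  by rewrite addnC /t_even /t_odd -(count_predC odd ns).
have le_f : (cycle_const (t_even ns) (t_odd ns))%:R + 1 <= f_const R ns.
  move: Et; rewrite /f_const /cycle_const; move: (t_even _) (t_odd _) => te to Et.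
  have -> : (35 : R) ^ ((2 ^ to)%N%:Z - 2) = 35 ^+ (2 ^ to) / 1225.
    rewrite expfzDr ?pnatr_eq0 //; congr (_ * _).
    by rewrite -exprnN -natrX.
  rewrite (_ : 82 * _ * _ = (82 * 35 ^ (2 ^ to) * 81 ^ te)%:R / 1225); last first.
    by rewrite !natrM !natrX; ring.
  rewrite ler_pdivlMr // natr1 -natrM ler_nat.
  have a34 : (34 * 34 ^ (2 ^ to).-1 <= 35 ^ 2 ^ to)%N.
    by rewrite -expnS prednK ?expn_gt0 // leq_exp2r ?expn_gt0.
  have b17 : (17 ^ te <= 81 ^ te)%N.
    by case: (te) => // te'; rewrite leq_exp2r.
  (* Let [T] be this product and [a] the constant. From [17a <= T], [1225(a + 1) <= 82T] follows
     once [T >= 124]; at least one cycle is required, as otherwise [T = 35]. *)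
  have big : (124 <= 35 ^ 2 ^ to * 81 ^ te)%N.
    case: to te Et {a34 b17} => [|to] [|te] Et; first by lia.
    + have : (81 ^ 1 <= 81 ^ te.+1)%N by rewrite leq_exp2l.
      by rewrite expn0 !expn1; lia.
    + have : (35 ^ 2 <= 35 ^ 2 ^ to.+1)%N by rewrite leq_exp2l // -{1}(expn1 2) leq_exp2l.
      by rewrite expn0 muln1; apply: leq_trans.
    have : (35 ^ 1 <= 35 ^ 2 ^ to.+1)%N by rewrite leq_exp2l // expn_gt0.
    have : (81 ^ 1 <= 81 ^ te.+1)%N by rewrite leq_exp2l.
    by rewrite !expn1; nia.
  have := leq_mul b17 a34; rewrite mulnCA; lia.
rewrite /c_const; case: eqP => // E2; rewrite le_min le_f andbT natr1 ler_nat.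
move: Et; rewrite E2 /cycle_const.
(* Three cases survive, with constants 578, 1156 and 78608. *)
case: (t_even ns) => [|[|[|te]]]; case: (t_odd ns) => [|[|[|to]]] Et;
  try (by exfalso; move: Et; clear; lia); clear; by vm_compute.
Qed.

Lemma cycle_const_gt1 te to : (1 < cycle_const te to)%N.
Proof. by rewrite /cycle_const mulnCA leq_pmulr // muln_gt0 !expn_gt0. Qed.

Theorem theorem3p2 (R : realType) (t : nat) (ht : (1 <= t)%N) :
  exists N : nat, forall ns : seq nat,
    size ns = t ->
    all (fun k => (0 < k)%N) ns ->
    let n := (\max_(k <- ns) k)%N in
    let c := c_const R ns in
    (N <= n)%N ->
    (forall i, (i < t)%N ->
       (nth 0%N ns i)%:Z >= 2 * Num.ceil (log2 (n%:R * c)) + 2) ->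
    (sizeRamsey ns)%:R <= (ln c + 1) * c ^+ 2 * n%:R.
Proof.
exists 1%N => ns ns_t _ n c n0 lens.
set a := cycle_const (t_even ns) (t_odd ns).
have a1 : (1 < a)%N by apply: cycle_const_gt1.
have ac : a%:R + 1 <= c by apply: cycle_const_le; rewrite ns_t.
have aR : 1 < a%:R :> R by rewrite ltr1n.
have nR : 1 <= n%:R :> R by rewrite ler1n.
have lnac : ln a%:R <= ln c by rewrite ler_ln ?posrE; lra.
have lna : 0 <= ln a%:R :> R by rewrite ln_ge0 ?ltW.
have nc1 : 1 <= n%:R * c by nra.
(* [D] serves twice: [an <= nc <= 2^D] bounds the vertex set, and the cycle lengths are at least
   [2D + 2]. *)
pose D := `|Num.ceil (log2 (n%:R * c))|%N.
have ln2 : 0 < ln 2 :> R by rewrite ln_gt0 ?ltr1n.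
have log0 : 0 <= log2 (n%:R * c) by apply: divr_ge0; [apply: ln_ge0|apply: ltW].
have ED : Num.ceil (log2 (n%:R * c)) = D%:Z.
  by rewrite gez0_abs // ceil_ge0; apply: lt_le_trans log0; rewrite ltrN10.
have ND : (a * n <= 2 ^ D)%N.
  rewrite -(ler_nat R) natrM natrX.
  have : log2 (n%:R * c) <= D%:R by have := ceil_ge (log2 (n%:R * c)); rewrite ED.
  rewrite /log2 ler_pdivrMr // [D%:R * _]mulr_natl -lnXn ?ltr0n //.
  rewrite ler_ln ?posrE ?exprn_gt0 ?ltr0n //; last lra.
  by apply: le_trans; rewrite mulrC ler_pM2l; lra.
pose B := (ln c + 1) * c ^+ 2 * n%:R.
(* Since [c >= a + 1] gives [c^2 >= a^2 + 2], there is a gap above 1, so the integer part of [B]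
   still exceeds the required number of draws. *)
have Blt : a%:R ^+ 2 * n%:R * (ln a%:R + 1) + 1 < B.
  have c2 : a%:R ^+ 2 + 2 <= c ^+ 2 by nra.
  have n1 : 1 <= n%:R * (ln a%:R + 1) :> R by nra.
  have n2 : n%:R * (ln a%:R + 1) <= n%:R * (ln c + 1) :> R by rewrite ler_pM2l; lra.
  have -> : B = c ^+ 2 * (n%:R * (ln c + 1)) by rewrite /B; ring.
  have : (a%:R ^+ 2 + 2) * (n%:R * (ln a%:R + 1)) <= c ^+ 2 * (n%:R * (ln c + 1)).
    by apply: ler_pM => //; nra.
  lra.
have B0 : 0 <= B.
  by apply: ltW; apply: le_lt_trans Blt; rewrite addr_ge0 ?mulr_ge0 ?exprn_ge0 ?ler0n //; lra.
have /andP[MB BM] := truncn_itv B0; set M := Num.trunc B in MB BM.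
have Mlt : a%:R ^+ 2 * n%:R * (ln a%:R + 1) < M%:R :> R.
  by move: BM; rewrite -natr1; lra.
have [e [sg ce dense]] := dense_graph (dense_graph_count a1 n0 Mlt).
have arr : arrows_cycles ns e.
  apply: (dense_graph_arrows sg _ n0 _ ND dense) => //.
  apply/(all_nthP 0%N) => i; rewrite ns_t => it; apply/andP; split.
    by have := lens i it; rewrite ED; clear; lia.
  by apply: leq_bigmax_seq => //; rewrite mem_nth ?ns_t.
apply: le_trans MB; rewrite ler_nat; apply: leq_trans ce; apply: sizeRamsey_le.
by exists 'I_(a * n), e.
Qed.
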